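(* Let $U$ be an $N\times N$ unitary complex Hadamard matrix, i.e. $U$ is unitary and $|U_{i,j}|^2=1/N$ for all $i,j$. Let $\mathcal D$ be the algebra of all $N\times N$ complex diagonal matrices and let $$[\mathcal D,\,U^*\mathcal DU]=\mathrm{span}_{\mathbb C}\{D_1\cdot U^*D_2U-U^*D_2U\cdot D_1:\ D_1,D_2\in\mathcal D\}.$$ Then $\mathbf d(U)=0$ if and only if $\dim_{\mathbb C}[\mathcal D,\,U^*\mathcal DU]=(N-1)^2$.
   Context: Let $f$ be the map sending a complex $N\times N$ matrix $U$ to the real matrix $(|U_{i,j}|^2)_{i,j}$, regarded as a smooth map between real vector spaces, with differential at $U$ given by $Df_U(V)=\big(2\,\mathrm{Re}(\overline{U_{i,j}}V_{i,j})\big)_{i,j}$. For an $N\times N$ unitary matrix $U$ let $T_U=\{EU: E\in\mathbb C^{N\times N},\ E^*=-E\}$ be the (real) tangent space at $U$ to the manifold of unitary matrices. The defect of $U$ is the integer $\mathbf d(U)=(N-1)^2-\dim_{\mathbb R}Df_U(T_U)$. *)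

(* Defs.v *)
From mathcomp Require Import all_boot all_order all_algebra.
From mathcomp Require Import spectral.
From mathcomp Require Import boolp classical_sets reals.
From mathcomp Require Import complex ring.

Set Implicit Arguments.
Unset Strict Implicit.
Unset Printing Implicit Defensive.

Import Order.TTheory GRing.Theory Num.Theory.
Import sesquilinear.

Local Open Scope sesquilinear_scope.
Local Open Scope classical_set_scope.
Local Open Scope ring_scope.

Section LinSpan.
Variables (K : fieldType) (V : vectType K).

(* The smallest subspace containing S; it exists by linspan_spec, so the
   default value 0%VS is never used. *)
Definition linspan (S : set V) : {vspace V} :=
  xget 0%VS [set W : {vspace V} | (forall v, S v -> v \in W) /\
    (forall W' : {vspace V}, (forall v, S v -> v \in W') -> (W <= W')%VS)].

Lemma linspan_seq (S : set V) : exists X : seq V,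
  (forall v, v \in X -> S v) /\ (forall v, S v -> v \in <<X>>%VS).
Proof.
pose P d := `[< exists X : seq V,
  (forall v, v \in X -> S v) /\ \dim <<X>>%VS = d >].
have exP : exists d, P d.
  by exists (\dim <<[::] : seq V>>%VS); apply/asboolP; exists [::].
have ubP d : P d -> (d <= \dim {:V})%N.
  by move=> /asboolP [X [_ <-]]; apply/dimvS/subvf.
case: (ex_maxnP exP ubP) => d /asboolP [X [XS dX]] dmax.
exists X; split=> // v Sv.
have /dmax : P (\dim <<v :: X>>%VS).
  apply/asboolP; exists (v :: X); split=> // w.
  by rewrite inE => /orP [/eqP -> //|/XS].
rewrite -dX => le_dim.
have sub : (<<X>> <= <<v :: X>>)%VS by rewrite span_cons addvSr.
have /eqP -> : (<<X>> == <<v :: X>>)%VS by rewrite eqEdim sub.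
by apply: memv_span; rewrite inE eqxx.
Qed.

Lemma linspan_spec (S : set V) :
  (forall v, S v -> v \in linspan S) /\
  (forall W : {vspace V}, (forall v, S v -> v \in W) -> (linspan S <= W)%VS).
Proof.
have [X [XS SX]] := linspan_seq S.
rewrite /linspan; case: xgetP => [W _ //|/(_ <<X>>%VS)[]]; split=> // W SW.
by apply/span_subvP => v /XS /SW.
Qed.

Lemma linspanP (S : set V) (v : V) :
  v \in linspan S <->
  exists X : seq V, (forall w, w \in X -> S w) /\ v \in <<X>>%VS.
Proof.
have [sub min] := linspan_spec S; split.
  have [X [XS SX]] := linspan_seq S.
  by move=> /(subvP (min _ SX)); exists X.
move=> [X [XS]]; apply/subvP/span_subvP => w /XS; exact: sub.
Qed.

Lemma linspan_id (S : set V) : S 0 ->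
  (forall (a : K) u v, S u -> S v -> S (a *: u + v)) ->
  forall v, v \in linspan S <-> S v.
Proof.
move=> S0 Slin v; split; last exact: (linspan_spec S).1.
move=> /linspanP [X [XS]]; rewrite -[X]in_tupleE => /coord_span ->.
have XS' (i : 'I_(size X)) : S (in_tuple X)`_i by exact/XS/mem_nth/ltn_ord.
elim/big_rec: _ => // i u _ Su; exact: Slin.
Qed.

End LinSpan.

Section Defect.
Variables (R : realType) (N : nat).
Local Notation C := (complex R).
Implicit Types U V E : 'M[C]_N.

(* The squared modulus is a nonnegative real of type C; complex.Re reads it
   in R. *)
Definition sqmod_mx U : 'M[R]_N := \matrix_(i, j) complex.Re (`|U i j| ^+ 2).

Definition dsqmod_mx U V : 'M[R]_N :=
  \matrix_(i, j) (2 * complex.Re ((U i j)^* * V i j)).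

Definition unitary_tangent U : set 'M[C]_N :=
  [set E *m U | E in [set E : 'M[C]_N | E ^t* = - E]].

(* The image of the tangent space is an R-subspace, hence its own linspan:
   see mem_dsqmod_image below. *)
Definition dsqmod_image U : {vspace 'M[R]_N} :=
  linspan (dsqmod_mx U @` unitary_tangent U).

(* An integer, so that the subtractions are not truncated. *)
Definition defect U : int := (N%:Z - 1) ^+ 2 - (\dim (dsqmod_image U))%:Z.

Definition unitary_hadamard U : Prop :=
  U \is unitarymx /\ forall i j, sqmod_mx U i j = N%:R^-1.

Definition diag_commutators U : {vspace 'M[C]_N} :=
  linspan [set D1 *m (U ^t* *m D2 *m U) - (U ^t* *m D2 *m U) *m D1
          | D1 in [set D : 'M[C]_N | is_diag_mx D]
          & D2 in [set D : 'M[C]_N | is_diag_mx D]].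

Lemma sqmod_mx_expand U V (t : R) :
  sqmod_mx (U + (real_complex R t) *: V) =
  sqmod_mx U + t *: dsqmod_mx U V + t ^+ 2 *: sqmod_mx V.
Proof.
apply/matrixP => i j; rewrite !mxE -!add_Re2_Im2 /=.
case: (U i j) (V i j) => a b [c d] /=; ring.
Qed.

Lemma mem_dsqmod_image U (M : 'M[R]_N) :
  M \in dsqmod_image U <->
  exists E : 'M[C]_N, E ^t* = - E /\ dsqmod_mx U (E *m U) = M.
Proof.
have tangentE W : (dsqmod_mx U @` unitary_tangent U) W <->
    exists E : 'M[C]_N, E ^t* = - E /\ dsqmod_mx U (E *m U) = W.
  split=> [[_ [E skE <-] <-]|[E [skE <-]]]; first by exists E.
  by exists (E *m U) => //; exists E.
rewrite -tangentE; apply: linspan_id => [|a W1 W2].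
  apply/tangentE; exists 0; split; first by rewrite trmx0 map_mx0 oppr0.
  by apply/matrixP => i j; rewrite mul0mx !mxE mulr0 /= mulr0.
move=> /tangentE [E1 [sk1 <-]] /tangentE [E2 [sk2 <-]]; apply/tangentE.
exists (real_complex R a *: E1 + E2); split.
  rewrite linearD linearZ /= map_mxD map_mxZ sk1 sk2 scalerN -opprD.
  by congr (- (_ *: _ + _)); apply/CrealP/complex_realP; exists a.
rewrite mulmxDl -scalemxAl; apply/matrixP => i j; rewrite !mxE.
by case: (U i j) (\sum_k _) (\sum_k _) => x y [p q] [r s] /=; ring.
Qed.

End Defect.

(* Main.v *)
(** For every unitary U the real dimension of Df_U(T_U) equals the complex
dimension of [D, U^* D U]. The commutator space is the image of the C-linear
map Phi(X)_ij = sum_k (X_ki - X_kj) conj(U_ki) U_kj. Since U is unitary,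
T_U = {U E : E skew-Hermitian}, and E |-> Df_U(U E) extends to a C-linear map
L of the variable E^T; every complex matrix is E1 + i E2 with E1, E2
skew-Hermitian, so the image of L is the complexification of Df_U(T_U). The
maps Phi and L are adjoint for the pairing sum_ij X_ij Y_ij, so they have the
same rank. *)
Require Import Defs.
From mathcomp Require Import all_boot all_order all_algebra.
From mathcomp Require Import boolp classical_sets reals complex.
From HB Require Import structures.
From mathcomp Require Import spectral ring.
Import GRing.Theory Num.Theory.
Local Open Scope ring_scope.

Set Implicit Arguments.
Unset Strict Implicit.
Import sesquilinear.
Local Open Scope sesquilinear_scope.

(** Turns the dimension of a subspace into the rank of a matrix, whose rows are the flattened
    vectors of a basis; ranks, unlike [\dim], can be compared across the fields [R] and [C]. *)
Lemma vspace_row_free_mx (K : fieldType) (m n : nat)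
    (W : {vspace 'M[K]_(m, n)}) :
  exists2 B : 'M[K]_(\dim W, m * n),
    row_free B & forall v, v \in W <-> (mxvec v <= B)%MS.
Proof.
pose B : 'M_(\dim W, m * n) := \matrix_i mxvec (vbasis W)`_i.
have mulB (u : 'rV_(\dim W)) :
    u *m B = mxvec (\sum_i u 0 i *: (vbasis W)`_i).
  rewrite mulmx_sum_row linear_sum; apply: eq_bigr => i _.
  by rewrite linearZ rowK.
exists B.
  apply: inj_row_free => u; rewrite mulB => /eqP.
  rewrite mxvec_eq0 => /eqP u0; apply/rowP => i; rewrite [RHS]mxE.
  by have /freeP/(_ (u 0) u0) := basis_free (vbasisP W); apply.
move=> v; split=> [vW|/submxP[u]].
  rewrite (coord_vbasis vW); apply/submxP.
  exists (\row_i coord (vbasis W) i v); rewrite mulB; congr mxvec.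
  by apply: eq_bigr => i _; rewrite mxE.
rewrite mulB => /(can_inj mxvecK) ->; apply: memv_suml => i _.
by apply/memvZ/vbasis_mem/mem_nth; rewrite size_tuple.
Qed.

Lemma sub_lin_mxP (K : fieldType) (m1 n1 m2 n2 : nat)
    (f : {linear 'M[K]_(m1, n1) -> 'M[K]_(m2, n2)}) (v : 'M_(m2, n2)) :
  (mxvec v <= lin_mx f)%MS <-> exists X, f X = v.
Proof.
split=> [/submxP[u]|[X <-]]; last by rewrite -mul_vec_lin submxMl.
by rewrite mul_rV_lin => /(can_inj mxvecK) ->; exists (vec_mx u).
Qed.

Lemma mulmx_mxvec_tr (K : fieldType) (m n : nat) (A B : 'M[K]_(m, n)) :
  (mxvec A *m (mxvec B)^T) 0 0 = \sum_i \sum_j A i j * B i j.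
Proof.
rewrite mxE (reindex _ (curry_mxvec_bij m n)) /= pair_bigA /=.
by apply: eq_bigr => -[i j] _ /=; rewrite mxE !mxvecE.
Qed.

(** By [mulmx_mxvec_tr] the pairing is the dot product of flattened matrices, so evaluating it at
    unit vectors reads off the entries of both matrices. *)
Lemma lin_mx_adjoint (K : fieldType) (m1 n1 m2 n2 : nat)
    (f : {linear 'M[K]_(m1, n1) -> 'M[K]_(m2, n2)})
    (g : {linear 'M[K]_(m2, n2) -> 'M[K]_(m1, n1)}) :
  (forall X (Y : 'M_(m2, n2)),
    \sum_i \sum_j f X i j * Y i j = \sum_i \sum_j X i j * g Y i j) ->
  lin_mx g = (lin_mx f)^T.
Proof.
move=> fg; apply/trmx_inj/matrixP => a b; rewrite trmxK.
have entry p q (M : 'M[K]_(p, q)) i j :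
    M i j =
    ((delta_mx 0 i : 'rV_p) *m M *m (delta_mx 0 j : 'rV_q)^T) 0 0.
  by rewrite trmx_delta -colE mxE -rowE mxE.
rewrite (entry _ _ (lin_mx f)) entry -mulmxA -trmx_mul !mul_rV_lin.
rewrite -{1}(vec_mxK 'e_a) -(vec_mxK 'e_b) !mulmx_mxvec_tr.
by rewrite !vec_mxK fg.
Qed.

Lemma trmxC_mul (C : numClosedFieldType) (m n p : nat) (A : 'M[C]_(m, n))
    (B : 'M[C]_(n, p)) : (A *m B) ^t* = B ^t* *m A ^t*.
Proof. by rewrite trmx_mul map_mxM. Qed.

Section Commutators.
Variables (R : realType) (N : nat).
Local Notation C := (complex R).
Implicit Types (U X Z E : 'M[C]_N).

(* The values at matrix units X are the commutators of matrix units of D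
   with those of U^* D U. *)
Definition diag_comm_map U X : 'M[C]_N :=
  \matrix_(i, j) \sum_k (X k i - X k j) * ((U k i)^* * U k j).

(** With [Z = E^T], this is [Df_U(U E)] written as [z + z^*], where each conjugate of [E k j] is
    replaced by [- E j k], its value for skew-Hermitian [E]. The replacement makes it [C]-linear. *)
Definition dsqmod_lin U Z : 'M[C]_N :=
  \matrix_(i, j)
    \sum_k ((U i j)^* * U i k * Z j k - (U i k)^* * U i j * Z k j).

Fact diag_comm_map_is_linear U : linear (diag_comm_map U).
Proof.
move=> a X Y; apply/matrixP => i j; rewrite !mxE mulr_sumr -big_split /=.
by apply: eq_bigr => k _; rewrite !mxE; ring.
Qed.
HB.instance Definition _ U :=
  GRing.isLinear.Build C _ _ _ (diag_comm_map U) (diag_comm_map_is_linear U).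

Fact dsqmod_lin_is_linear U : linear (dsqmod_lin U).
Proof.
move=> a X Y; apply/matrixP => i j; rewrite !mxE mulr_sumr -big_split /=.
by apply: eq_bigr => k _; rewrite !mxE; ring.
Qed.
HB.instance Definition _ U :=
  GRing.isLinear.Build C _ _ _ (dsqmod_lin U) (dsqmod_lin_is_linear U).

Lemma diag_comm_map_adjoint U X Z :
  \sum_i \sum_j diag_comm_map U X i j * Z i j =
  \sum_i \sum_j X i j * dsqmod_lin U Z i j.
Proof.
pose F k i j := X k i * ((U k i)^* * U k j) * Z i j.
pose G k i j := X k j * ((U k i)^* * U k j) * Z i j.
transitivity (\sum_k \sum_i \sum_j (F k i j - G k i j)).
  rewrite [RHS]exchange_big; apply: eq_bigr => i _ /=.
  rewrite [RHS]exchange_big; apply: eq_bigr => j _ /=.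
  by rewrite mxE mulr_suml; apply: eq_bigr => k _; rewrite /F /G; ring.
apply: eq_bigr => k _.
(* Swapping [i] and [j] in the [G] part leaves the common factor [X k i]. *)
transitivity (\sum_i \sum_j (F k i j - G k j i)).
  under eq_bigr do rewrite sumrB.
  under [in RHS]eq_bigr do rewrite sumrB.
  by rewrite !sumrB; congr (_ - _); rewrite exchange_big.
apply: eq_bigr => i _; rewrite mxE mulr_sumr.
by apply: eq_bigr => j _; rewrite /F /G; ring.
Qed.

Lemma mem_diag_commutators U X :
  X \in diag_commutators U <-> (mxvec X <= lin_mx (diag_comm_map U))%MS.
Proof.
rewrite sub_lin_mxP; split.
  move=> /linspanP [s [sP]].
  rewrite -[s]in_tupleE => /coord_span ->.
  set c := coord _; have : forall i : 'I_(size s), exists Y,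
    diag_comm_map U Y = (in_tuple s)`_i.
    move=> i; have /sP [D1 d1 [D2 d2 <-]] : s`_i \in s by exact: mem_nth.
    have /diag_mxP [e1 ->] := d1; have /diag_mxP [e2 ->] := d2.
    (* The commutator of [diag e1] with [U^* (diag e2) U] is the image of the rank-one matrix
       [e2^T e1]. *)
    exists (\matrix_(k, l) (e2 0 k * e1 0 l)).
    rewrite -mulmxA !mul_diag_mx mul_mx_diag; apply/matrixP => p q.
    rewrite !mxE mulr_sumr mulr_suml -sumrB.
    by apply: eq_bigr => k _; rewrite !mxE; ring.
  move=> /(_ _)/cid-/all_sig [Y YP].
  exists (\sum_i c i X *: Y i); rewrite linear_sum.
  by apply: eq_bigr => i _; rewrite linearZ /= YP.
move=> [Y <-] /=.
(* Conversely, split [Y] into rows: row [k] gives [D1], and the matrix unit at [(k, k)] gives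
   [D2]. *)
have -> : diag_comm_map U Y = \sum_k
    (diag_mx (row k Y) *m (U ^t* *m delta_mx k k *m U)
     - (U ^t* *m delta_mx k k *m U) *m diag_mx (row k Y)).
  apply/matrixP => i j; rewrite mxE summxE; apply: eq_bigr => k _.
  rewrite mul_diag_mx mul_mx_diag !mxE (bigD1 k) //= big1 => [|l lk].
    rewrite mxE (bigD1 k) //= big1 => [|l lk].
      by rewrite !mxE !eqxx /=; ring.
    by rewrite !mxE (negbTE lk) mulr0.
  rewrite mxE big1 ?mul0r // => q _.
  by rewrite !mxE (negbTE lk) andbF mulr0.
apply: memv_suml => k _; apply: (linspan_spec _).1.
exists (diag_mx (row k Y)); first exact: diag_mx_is_diag.
exists (delta_mx k k) => //; apply/is_diag_mxP => i j ij.
rewrite mxE; case: eqVneq => // ik; case: eqVneq => // jk.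
by rewrite ik jk eqxx in ij.
Qed.

Lemma dsqmod_linE U E : E ^t* = - E ->
  dsqmod_lin U E^T = map_mx (real_complex R) (dsqmod_mx U (U *m E)).
Proof.
move=> skE; apply/matrixP => i j; rewrite !mxE.
have conj_entry k l : (E k l)^* = - E l k.
  by move/matrixP: skE => /(_ l k); rewrite !mxE.
pose z := (U i j)^* * \sum_k U i k * E k j.
transitivity (z + z^*).
  rewrite /z rmorphM /= conjCK rmorph_sum !mulr_sumr -big_split /=.
  apply: eq_bigr => k _; rewrite rmorphM /= conj_entry !mxE; ring.
by rewrite [LHS]addcJ rmorphM rmorph_nat.
Qed.

(** Conjugation by [U] preserves skew-Hermitian matrices, and [E U = U (U^* E U)]. *)
Lemma mem_dsqmod_image_unitary U (M : 'M[R]_N) : U \is unitarymx ->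
  M \in dsqmod_image U <->
  exists E, E ^t* = - E /\ dsqmod_mx U (U *m E) = M.
Proof.
move=> /unitarymxP UU; have UU' := mulmx1C UU.
rewrite mem_dsqmod_image; split=> -[E [skE <-]].
  exists (U ^t* *m E *m U); rewrite !mulmxA UU mul1mx; split=> //.
  by rewrite !trmxC_mul trmxCK skE mulNmx mulmxN mulmxA.
exists (U *m E *m U ^t*); rewrite -!mulmxA UU' mulmx1; split=> //.
by rewrite !trmxC_mul trmxCK skE mulmxN mulNmx mulmxA.
Qed.

Lemma skew_decomposition Z : exists E1 E2 : 'M[C]_N,
  [/\ E1 ^t* = - E1, E2 ^t* = - E2 & Z = E1^T + 'i *: E2^T].
Proof.
(* [E1] is the skew-Hermitian part of [Z^T]; [E2] is its Hermitian part multiplied by [- 'i]. *)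
exists (\matrix_(i, j) (2^-1 * (Z j i - (Z i j)^* ))).
exists (\matrix_(i, j) (- ('i / 2) * (Z j i + (Z i j)^* ))).
split; apply/matrixP => i j; rewrite !mxE.
- by rewrite rmorphM rmorphB /= conjCK fmorphV rmorph_nat; ring.
- rewrite !(rmorphM, rmorphN, rmorphD) /= fmorphV rmorph_nat conjCK conjCi.
  by ring.
by rewrite mulrA mulrN mulrA -expr2 sqrCi; field.
Qed.

Lemma dim_dsqmod_image U : U \is unitarymx ->
  \dim (dsqmod_image U) = \dim (diag_commutators U).
Proof.
move=> uU.
have [B freeB BP] := vspace_row_free_mx (dsqmod_image U).
have [A freeA AP] := vspace_row_free_mx (diag_commutators U).
have -> : \dim (diag_commutators U) = \rank (lin_mx (diag_comm_map U)).
  rewrite -(eqP freeA); apply/eqmx_rank/andP; split.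
    apply/row_subP => i; rewrite -[row i A]vec_mxK.
    by apply/mem_diag_commutators/AP; rewrite vec_mxK row_sub.
  apply/row_subP => i; rewrite -[row i _]vec_mxK.
  by apply/AP/mem_diag_commutators; rewrite vec_mxK row_sub.
(* Transposition passes to the adjoint [dsqmod_lin]. Extending scalars preserves the rank of [B], so
   it remains to compare two row spaces over [C]. *)
rewrite -mxrank_tr -(lin_mx_adjoint (diag_comm_map_adjoint U)).
rewrite -(eqP freeB) -(mxrank_map (real_complex R)).
apply/eqmx_rank/andP; split; apply/row_subP => i.
  rewrite -map_row -[row i B]vec_mxK map_mxvec; apply/sub_lin_mxP.
  have /BP : (mxvec (vec_mx (row i B)) <= B)%MS by rewrite vec_mxK row_sub.
  move=> /(mem_dsqmod_image_unitary _ uU) [E [skE <-]].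
  by exists E^T; rewrite -dsqmod_linE.
have real E : E ^t* = - E ->
    (mxvec (dsqmod_lin U E^T) <= map_mx (real_complex R) B)%MS.
  move=> skE; rewrite dsqmod_linE // -map_mxvec map_submx; apply/BP.
  by apply/(mem_dsqmod_image_unitary _ uU); exists E.
(* Each row is the value of [dsqmod_lin] at a matrix unit, hence a complex combination of two values
   covered by [real]. *)
rewrite rowE mul_rV_lin.
have [E1 [E2 [sk1 sk2 ->]]] := skew_decomposition (vec_mx 'e_i).
by rewrite !linearD !linearZ /= addmx_sub ?scalemx_sub ?real.
Qed.

End Commutators.

Theorem mainTheorem11 (R : realType) (N : nat) (U : 'M[complex R]_N)
  (hU : unitary_hadamard U) :
  defect U = 0 <-> (\dim (diag_commutators U))%:Z = (N%:Z - 1) ^+ 2.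
Proof.
rewrite /defect (dim_dsqmod_image hU.1).
by split=> [/eqP|->]; rewrite ?subrr // subr_eq0 => /eqP.
Qed.
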